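(* Let $V=V_1\uplus\cdots\uplus V_k$ be a finite ground set partitioned into disjoint nonempty sets, let $b_1,\dots,b_k$ be integers with $1\le b_i\le |V_i|$, let $n=|V|$, $b=\sum_{i}b_i$, $\hat b=\min_i b_i$, and let $f:2^V\to\mathbb{R}_{\ge0}$ be monotone with $f(\emptyset)=0$, with PM diminishing-return ratio $\gamma$ and PM curvature $\alpha$ (defined in the context). Let $S_b$ be the output of \textsc{Greedy} (described in the context) and $S^*$ a maximizer of $f$ over $\{S\subseteq V:|S\cap V_i|\le b_i\ \forall i\}$. Then \textsc{Greedy} obtains a $\min\big(\frac{1}{r_1^{(g)}},\frac{1}{r_2^{(g)}}\big)$-approximation solution, i.e. $f(S^* )\le\min\big(\frac{1}{r_1^{(g)}},\frac{1}{r_2^{(g)}}\big) f(S_b)$, where $$r_1^{(g)}=\frac{\gamma}{1+\gamma\alpha},\qquad r_2^{(g)}=\frac1\alpha\Big[1-\Big(1-\frac{\alpha\gamma}{b}\Big)^{\hat b}\Big],$$ and \textsc{Greedy} uses $O(nb)$ queries of $f$.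
   Context: $\Delta_e f(S):=f(S\cup\{e\})-f(S)$. The PM diminishing-return ratio $\gamma$ is the maximum value in $[0,1]$ with $\Delta_e f(T)\le\frac1\gamma\Delta_e f(S)$ for all $S\subseteq T\subseteq V$ with $|(T\setminus S)\cap V_i|\le b_i\ \forall i\in[k]$ and all $e\in V\setminus T$; the PM curvature $\alpha$ is the minimum value in $[0,1]$ with $\Delta_e f(T)\ge(1-\alpha)\Delta_e f(S)$ for all such $S,T,e$. Algorithm \textsc{Greedy}: set $I=[k]$, $S_0=\emptyset$, $t=0$. While $I\neq\emptyset$: pick $(e,i)\in\arg\max\{\Delta_e f(S_t): i\in I,\ e\in V_i\setminus S_t\}$; set $S_{t+1}=S_t\cup\{e\}$, $t=t+1$; if $|S_t\cap V_i|\ge b_i$ remove $i$ from $I$. Return $S_b$. *)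

(* Defs.v *)
From mathcomp Require Import all_boot all_order all_algebra.
From mathcomp Require Import constructive_ereal reals.

Set Implicit Arguments.
Unset Strict Implicit.
Unset Printing Implicit Defensive.

Import Order.TTheory GRing.Theory Num.Theory.
Local Open Scope ring_scope.

(** * Oracle computations

    A program accesses the set function only through [Query]. [Pick s k]
    continues with an arbitrary element of [s], so that ties in an argmax may be
    broken in any way. *)
Inductive oprog (V : finType) (R A : Type) : Type :=
| Ret of A
| Query of {set V} & (R -> oprog V R A)
| Pick (T : eqType) of seq T & (T -> oprog V R A).

Arguments Ret {V R A} _.
Arguments Query {V R A} _ _.
Arguments Pick {V R A T} _ _.

(** [exec f p a q]: with oracle [f], the program [p] can return [a] after making
    exactly [q] queries. *)
Fixpoint exec (V : finType) (R A : Type) (f : {set V} -> R)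
    (p : oprog V R A) (a : A) (q : nat) : Prop :=
  match p with
  | Ret x => a = x /\ q = 0%N
  | Query X k => exists2 q' : nat, q = q'.+1 & exec f (k (f X)) a q'
  | Pick T s k => exists2 x : T, x \in s & exec f (k x) a q
  end.

Section PartitionMatroid.

Variables (R : realType) (V : finType) (k : nat).
Variables (part : 'I_k -> {set V}) (bud : 'I_k -> nat).

Definition is_partition : Prop :=
  [/\ forall i, part i != set0,
      forall i j, i != j -> [disjoint part i & part j]
    & \bigcup_i part i = [set: V]].

Definition total_budget : nat := (\sum_i bud i)%N.

(** Every [bud i] is at most [total_budget], so for [0 < k] this is the minimum
    of the [bud i]. *)
Definition min_budget : nat := \big[minn/total_budget]_i bud i.

Definition feasible (S : {set V}) : Prop :=
  forall i, (#|S :&: part i| <= bud i)%N.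

Definition monotone_setfun (f : {set V} -> R) : Prop :=
  forall A B : {set V}, A \subset B -> f A <= f B.

Definition marginal (f : {set V} -> R) (e : V) (S : {set V}) : R :=
  f (e |: S) - f S.

Definition is_optimal (f : {set V} -> R) (S : {set V}) : Prop :=
  feasible S /\ forall S', feasible S' -> f S' <= f S.

(** [x <= C * y] for an extended factor [C]. Factors are inverses, with
    1/0 = +oo; an infinite factor imposes no constraint, even when [y = 0]
    (whereas [+oo * 0 = 0] in [\bar R]). *)
Definition le_scaled (x : R) (C : \bar R) (y : R) : Prop :=
  match C with
  | EFin c => x <= c * y
  | EPInf => True
  | ENInf => False
  end.

Definition pm_triple (S T : {set V}) (e : V) : Prop :=
  [/\ S \subset T, forall i, (#|(T :\: S) :&: part i| <= bud i)%N
    & e \notin T].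

Definition pm_dr_bound (f : {set V} -> R) (g : R) : Prop :=
  0 <= g <= 1 /\
  forall S T e, pm_triple S T e ->
    le_scaled (marginal f e T) (inve g%:E) (marginal f e S).

Definition is_pm_dr_ratio (f : {set V} -> R) (g : R) : Prop :=
  pm_dr_bound f g /\ forall g', pm_dr_bound f g' -> g' <= g.

Definition pm_curvature_bound (f : {set V} -> R) (a : R) : Prop :=
  0 <= a <= 1 /\
  forall S T e, pm_triple S T e ->
    marginal f e T >= (1 - a) * marginal f e S.

Definition is_pm_curvature (f : {set V} -> R) (a : R) : Prop :=
  pm_curvature_bound f a /\ forall a', pm_curvature_bound f a' -> a <= a'.

(** * Greedy *)

(** Evaluates each marginal from its definition, that is, with two queries. *)
Fixpoint with_marginals (A : Type) (S : {set V}) (cs : seq (V * 'I_k))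
    (kont : seq ((V * 'I_k) * R) -> oprog V R A) : oprog V R A :=
  match cs with
  | [::] => kont [::]
  | c :: cs' =>
      Query (c.1 |: S) (fun x => Query S (fun y =>
        with_marginals S cs' (fun l => kont ((c, x - y) :: l))))
  end.

Definition candidates (I : {set 'I_k}) (S : {set V}) : seq (V * 'I_k) :=
  enum [set c : V * 'I_k | (c.2 \in I) && (c.1 \in part c.2 :\: S)].

Definition argmaxes (T : Type) (l : seq (T * R)) : seq T :=
  [seq p.1 | p <- l & all (fun p' => p'.2 <= p.2) l].

Definition greedy_state : Type := ({set 'I_k} * {set V})%type.

Definition greedy_step (st : greedy_state) : oprog V R greedy_state :=
  let I := st.1 in let S := st.2 in
  with_marginals S (candidates I S) (fun l =>
    Pick (argmaxes l) (fun c =>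
      let S' := c.1 |: S in
      Ret (if (bud c.2 <= #|S' :&: part c.2|)%N then I :\ c.2 else I, S'))).

(** [greedy_reaches f st q]: from [I = [k]], [S = set0], the while loop can be
    in state [st] after some number of iterations, having made [q] queries. *)
Inductive greedy_reaches (f : {set V} -> R) : greedy_state -> nat -> Prop :=
| greedy_start : greedy_reaches f ([set: 'I_k], set0) 0
| greedy_iter I S st q q' :
    greedy_reaches f (I, S) q -> I != set0 ->
    exec f (greedy_step (I, S)) st q' ->
    greedy_reaches f st (q + q').

Definition greedy_output (f : {set V} -> R) (S : {set V}) : Prop :=
  exists q, greedy_reaches f (set0, S) q.

Definition ratio1 (g a : R) : R := g / (1 + g * a).

(** At [a = 0] the formula reads 0/0; its value is then the limit as [a] tends
    to 0. *)
Definition ratio2 (g a : R) : R :=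
  if a == 0 then g * min_budget%:R / total_budget%:R
  else a^-1 * (1 - (1 - a * g / total_budget%:R) ^+ min_budget).

End PartitionMatroid.

(* Main.v *)
Require Import Defs.
From mathcomp Require Import all_boot all_order all_algebra.
From mathcomp Require Import constructive_ereal reals.
From mathcomp Require Import ring lra zify.

Set Implicit Arguments.
Unset Strict Implicit.
Unset Printing Implicit Defensive.

Import Order.TTheory GRing.Theory Num.Theory.
Local Open Scope ring_scope.

(** Both bounds follow the greedy chain [S] one step at a time.

    For [ratio1], keep a remainder [O] of the optimum such that [S :|: O] stays
    feasible. When greedy adds [e] from block [i], trade it for an element [o]
    of [O] in the same block: [o] was a candidate too, so the loss is at most
    [(gamma^-1 - 1 + alpha)] times the greedy gain, and these losses add up to
    that multiple of [f Sb].

    For [ratio2], no block is full during the first [min_budget] steps, so the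
    greedy gain [x] satisfies [gamma * D <= c * x], where
    [D = f (Sopt :|: S) - f S] and [c = b - #|Sopt :&: S|]. If [e] is not in
    [Sopt], then [D] drops by at most [alpha * x]; otherwise it drops by [x],
    but [c] drops by one as well. The potential
    [f S + D * geom_ratio gamma alpha (N - #|S|) c] therefore never decreases,
    where [N] is [min_budget]. The second case rests on
    [(1 - p / d.+1) ^+ j.+1 <= (1 - p / d) ^+ j] for [j < d], an instance of
    Bernoulli's inequality. *)

(** * Estimates for the geometric sums behind [ratio2] *)

Section GeometricRatio.

Variable R : realFieldType.
Implicit Types (g a p x y D : R) (n c d j : nat).

Lemma bernoulli_le x n : 0 <= x <= 1 -> 1 - n%:R * x <= (1 - x) ^+ n.
Proof.
move=> /andP[x0 x1]; elim: n => [|n IHn]; first by rewrite expr0 mul0r subr0.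
rewrite exprS -natr1.
have h : (1 - x) * (1 - n%:R * x) <= (1 - x) * (1 - x) ^+ n.
  by apply: ler_wpM2l; [lra | exact: IHn].
apply: le_trans h; have n0 : 0 <= n%:R :> R by [].
have : 0 <= n%:R * (x * x) by rewrite !mulr_ge0.
nra.
Qed.

(** Write [1 - p / d] as [v * (1 - w)] with [v = 1 - p / d.+1]. Cancelling [v ^+ j] leaves
    [v <= (1 - w) ^+ j], which Bernoulli gives because [j * w <= p / d.+1]. *)
Lemma expr_succ_le_expr p d j : 0 <= p <= 1 -> (j < d)%N ->
  (1 - p / d.+1%:R) ^+ j.+1 <= (1 - p / d%:R) ^+ j.
Proof.
move=> /andP[p0 p1] jd.
have d1 : 1 <= d%:R :> R by rewrite ler1n; lia.
have jd1 : j%:R + 1 <= d%:R :> R by rewrite natr1 ler_nat.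
have j0 : 0 <= j%:R :> R by [].
have dp : 0 < d%:R * (d%:R + 1 - p) :> R by apply: mulr_gt0; lra.
set v := 1 - p / d.+1%:R; set w := p / (d%:R * (d%:R + 1 - p)) : R.
have w0 : 0 <= w by rewrite divr_ge0 // ltW.
have w1 : w <= 1 by rewrite ler_pdivrMr // mul1r; nra.
have v0 : 0 <= v.
  by rewrite subr_ge0 ler_pdivrMr ?ltr0n // mul1r -natr1; lra.
have -> : 1 - p / d%:R = v * (1 - w).
  by rewrite /v /w -natr1; field; apply/and3P; split; apply: lt0r_neq0; lra.
rewrite exprS exprMn mulrC; apply: ler_wpM2l; first exact: exprn_ge0.
apply: le_trans (bernoulli_le j _); last by rewrite w0.
rewrite lerD2l lerN2 /w mulrCA; apply: ler_wpM2l => //.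
rewrite ler_pdivrMr // mulrC ler_pdivlMr ?ltr0n // -natr1; nra.
Qed.

(* [ratio2] with its geometric sum expanded, which also covers [a = 0]. *)
Definition geom_ratio g a n c : R :=
  g / c%:R * \sum_(j < n) (1 - a * g / c%:R) ^+ j.

Lemma geom_ratioS g a n c :
  geom_ratio g a n.+1 c = g / c%:R + (1 - a * g / c%:R) * geom_ratio g a n c.
Proof.
rewrite /geom_ratio big_ord_recl expr0 mulrDr mulr1; congr (_ + _).
rewrite mulrCA; congr (_ * _); rewrite mulr_sumr.
by apply: eq_bigr => i _; rewrite exprS.
Qed.

Variables (g a : R).
Hypotheses (g0 : 0 <= g) (g1 : g <= 1) (a0 : 0 <= a) (a1 : a <= 1).

Let p01 : 0 <= a * g <= 1.
Proof. by rewrite mulr_ge0 ?mulr_ile1. Qed.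

Let q01 c : (0 < c)%N -> 0 <= 1 - a * g / c%:R <= 1.
Proof.
have /andP[p0 p1] := p01 => c0.
have c1 : 1 <= c%:R :> R by rewrite ler1n.
have h : 0 <= a * g / c%:R by rewrite divr_ge0.
have h' : a * g / c%:R <= 1 by rewrite ler_pdivrMr; lra.
by apply/andP; split; lra.
Qed.

Lemma geom_ratio_ge0 n c : (0 < c)%N -> 0 <= geom_ratio g a n c.
Proof.
move=> /q01/andP[h _]; apply: mulr_ge0; first by rewrite divr_ge0.
by apply: sumr_ge0 => j _; apply: exprn_ge0.
Qed.

Lemma geom_ratio_le1 n c : (n <= c)%N -> geom_ratio g a n c <= 1.
Proof.
(* Since [g / 0] is 0, the ratio vanishes at [c = 0]. *)
case: c => [|c] nc; first by rewrite /geom_ratio invr0 mulr0 mul0r.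
have c0 : 0 < c.+1%:R :> R by rewrite ltr0n.
have /andP[q0 q1] := q01 (ltn0Sn c).
have : \sum_(j < n) (1 - a * g / c.+1%:R) ^+ j <= c.+1%:R.
  apply: (@le_trans _ _ n%:R); last by rewrite ler_nat.
  have -> : n%:R = \sum_(j < n) 1 :> R by rewrite sumr_const card_ord.
  by apply: ler_sum => j _; apply: exprn_ile1.
move=> h; rewrite /geom_ratio mulrAC ler_pdivrMr // mul1r.
apply: le_trans h; apply: ler_piMl => //.
by apply: sumr_ge0 => j _; apply: exprn_ge0.
Qed.

(** The factor on the left raises every exponent by one, so [expr_succ_le_expr] compares the sums
    term by term. For [c > 0] the outer coefficients differ by [g * (1 - g) / (c * c.+1)]. *)
Lemma geom_ratio_le n c : (n <= c)%N ->
  (1 - a * g / c.+1%:R) * geom_ratio g a n c.+1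
    <= (1 - g / c.+1%:R) * geom_ratio g a n c.
Proof.
move=> nc; case: (posnP c) => [c0|c0].
  by have -> : n = 0%N by [lia]; rewrite /geom_ratio !big_ord0 !mulr0.
have c1 : 1 <= c%:R :> R by rewrite ler1n.
have cS0 : 0 < c.+1%:R :> R by rewrite ltr0n.
rewrite /geom_ratio mulrCA mulr_sumr [leRHS]mulrA.
under eq_bigr do rewrite -exprS.
apply: ler_pM.
- by rewrite divr_ge0.
- apply: sumr_ge0 => j _; apply: exprn_ge0.
  by have /andP[] := q01 (ltn0Sn c).
- rewrite -subr_ge0.
  have -> : (1 - g / c.+1%:R) * (g / c%:R) - g / c.+1%:R
      = g * (1 - g) / (c%:R * c.+1%:R).
    by rewrite -natr1; field; apply/andP; split; apply: lt0r_neq0; lra.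
  by rewrite divr_ge0 // mulr_ge0 // subr_ge0.
- apply: ler_sum => j _; apply: expr_succ_le_expr p01 _.
  by have := ltn_ord j; lia.
Qed.

(** With [y = g / c] and [r] the ratio at [n], the gap for [D' = D - a * x] is exactly
    [(x - D * y) * (1 - a * r)], a product of nonnegative factors. *)
Lemma geom_ratio_step_out n c D D' x : (n < c)%N -> 0 <= D -> 0 <= x ->
    g * D <= c%:R * x -> D - a * x <= D' ->
  D * geom_ratio g a n.+1 c <= x + D' * geom_ratio g a n c.
Proof.
move=> nc D0 x0 gDx DD'; have c0 : (0 < c)%N by lia.
have cR : 0 < c%:R :> R by rewrite ltr0n.
have r0 := geom_ratio_ge0 n c0; have r1 := geom_ratio_le1 (ltnW nc).
have h1 : (D - a * x) * geom_ratio g a n c <= D' * geom_ratio g a n c.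
  exact: ler_wpM2r.
have yx : D * (g / c%:R) <= x by rewrite mulrA ler_pdivrMr //; lra.
rewrite geom_ratioS -(mulrA a); set y := g / _ in yx *.
set r := geom_ratio _ _ _ _ in r0 r1 h1 *.
have : 0 <= (x - D * y) * (1 - a * r).
  by apply: mulr_ge0; rewrite subr_ge0 // mulr_ile1.
nra.
Qed.

(** Once [geom_ratio_le] has traded [c.+1] for [c], the gap is [(x - D * y) * (1 - r)], where
    [y = g / c.+1] and [r] is the ratio at [n] and [c]. *)
Lemma geom_ratio_step_in n c D x : (n <= c)%N -> 0 <= D -> 0 <= x ->
    g * D <= c.+1%:R * x ->
  D * geom_ratio g a n.+1 c.+1 <= x + (D - x) * geom_ratio g a n c.
Proof.
move=> nc D0 x0 gDx.
have cR : 0 < c.+1%:R :> R by rewrite ltr0n.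
have r1 := geom_ratio_le1 nc.
have h := ler_wpM2l D0 (geom_ratio_le nc).
have yx : D * (g / c.+1%:R) <= x by rewrite mulrA ler_pdivrMr //; lra.
rewrite geom_ratioS mulrDr; set y := g / _ in h yx *.
set z := D * (_ * geom_ratio _ _ n c.+1) in h *.
set r := geom_ratio _ _ n c in h r1 *.
have : 0 <= (x - D * y) * (1 - r) by apply: mulr_ge0; lra.
nra.
Qed.

End GeometricRatio.

(** * Executions of the greedy program *)

Section GreedyRuns.

Variables (R : realType) (V : finType) (k : nat).
Variables (part : 'I_k -> {set V}) (bud : 'I_k -> nat) (f : {set V} -> R).
Implicit Types (S T O : {set V}) (e o : V) (i j : 'I_k).

Lemma exec_with_marginals (A : Type) S cs
    (kont : seq ((V * 'I_k) * R) -> oprog V R A) a q :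
  exec f (with_marginals S cs kont) a q ->
  exists2 q', q = (2 * size cs + q')%N &
    exec f (kont [seq (c, marginal f c.1 S) | c <- cs]) a q'.
Proof.
elim: cs kont q => [|c cs IH] kont q /=; first by exists q.
move=> [_ -> [q1 ->]] /IH[q2 -> h]; exists q2 => //; lia.
Qed.

Lemma mem_argmaxes (T : eqType) (l : seq T) (g : T -> R) c :
  c \in argmaxes [seq (x, g x) | x <- l] ->
  c \in l /\ forall c', c' \in l -> g c' <= g c.
Proof.
rewrite /argmaxes => /mapP[p]; rewrite mem_filter => /andP[/allP le_c].
move=> /mapP[x xl pE] ->; rewrite pE in le_c *; split=> // c' c'l.
exact: (le_c (c', g c') (map_f _ c'l)).
Qed.

Lemma greedy_stepP I S st q : exec f (greedy_step R part bud (I, S)) st q ->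
  exists e i,
    [/\ i \in I, e \in part i :\: S,
        forall e' j, j \in I -> e' \in part j :\: S ->
          marginal f e' S <= marginal f e S,
        st = (if (bud i <= #|(e |: S) :&: part i|)%N then I :\ i else I, e |: S)
      & q = (2 * size (candidates part I S))%N].
Proof.
rewrite /greedy_step => h.
have [q' -> /= [[e i] c_max]] := exec_with_marginals h.
have [] := mem_argmaxes c_max.
rewrite mem_enum inE /= => /andP[iI ePi] max_e [-> ->]; exists e, i; split=> //.
  by move=> e' j jI e'P; apply: (max_e (e', j)); rewrite mem_enum inE /= jI.
by rewrite addn0.
Qed.

(** * Counting along the partition *)

Hypothesis part_partition : is_partition part.

Lemma in_part_eq e i j : e \in part i -> (e \in part j) = (j == i).
Proof.
case: part_partition => _ dis _ ePi; case: (eqVneq j i) => [->//|ji].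
by apply/negbTE; rewrite (disjointFl (dis _ _ ji)).
Qed.

Lemma in_part_ex e : exists i, e \in part i.
Proof.
case: part_partition => _ _ cov.
by have: e \in [set: V] by []; rewrite -cov => /bigcupP[i _]; exists i.
Qed.

Lemma card_sum_part S : #|S| = (\sum_i #|S :&: part i|)%N.
Proof.
rewrite -sum1_card.
have -> : (\sum_i #|S :&: part i| = \sum_i \sum_(e in S) (e \in part i))%N.
  apply: eq_bigr => i _; rewrite -sum1_card.
  under eq_bigl do rewrite inE.
  by rewrite big_mkcondr /=; apply: eq_bigr => e _; case: (_ \in _).
rewrite exchange_big /=; apply: eq_bigr => e _.
have [i ePi] := in_part_ex e.
under eq_bigr do rewrite (in_part_eq _ ePi).
by rewrite (bigD1 i) //= eqxx big1 // => j /negPf->.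
Qed.

Lemma card_setU1I S T e : e \notin S ->
  #|(e |: S) :&: T| = ((e \in T) + #|S :&: T|)%N.
Proof.
move=> eS; rewrite setIUl; case: (boolP (e \in T)) => eT.
  rewrite (setIidPl _) ?sub1set // cardsU1 inE (negPf eS) //.
rewrite (_ : [set e] :&: T = set0) ?set0U //.
by apply/eqP; rewrite setI_eq0 disjoints1.
Qed.

(** An element determines its block, so [fst] is injective on candidates. *)
Lemma size_candidates I S : (size (candidates part I S) <= #|V|)%N.
Proof.
rewrite -cardE -(@card_in_imset _ _ fst) ?max_card //.
move=> [e i] [e' j] /=; rewrite !inE /= => /and3P[_ _ ei] /and3P[_ _ ej] E.
by move: ej; rewrite -E (in_part_eq _ ei) => /eqP->.
Qed.

Lemma feasible_card S : feasible part bud S -> (#|S| <= total_budget bud)%N.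
Proof. by move=> feaS; rewrite card_sum_part; apply: leq_sum. Qed.

(** * Loop invariants and the number of queries *)

Definition greedy_choice S e i : Prop :=
  [/\ e \in part i, e \notin S, (#|S :&: part i| < bud i)%N
    & forall e' j, e' \in part j -> e' \notin S ->
        (#|S :&: part j| < bud j)%N -> marginal f e' S <= marginal f e S].

Hypothesis bud_gt0 : forall i, (0 < bud i)%N.

(** Since [I] always consists of the blocks with room left, an argmax over the candidates is a
    [greedy_choice], which no longer mentions [I]. Each iteration makes at most [2 * #|V|] queries
    and adds one new element, whence the last bound. *)
Lemma greedy_reaches_ind_choice (P : {set V} -> Prop) :
    P set0 ->
    (forall S e i, feasible part bud S -> greedy_choice S e i ->
       P S -> P (e |: S)) ->
  forall st q, greedy_reaches part bud f st q ->
    [/\ P st.2, feasible part bud st.2,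
        forall i, (i \in st.1) = (#|st.2 :&: part i| < bud i)%N
      & (q <= 2 * (#|V| * #|st.2|))%N].
Proof.
move=> P0 PS st q; elim=> {st q} [|I S st q q' _ [/= PSS fea inI qle] _].
  by split=> // i; rewrite ?inE set0I cards0 ?bud_gt0.
move=> /greedy_stepP[e [i [iI]]]; rewrite inE => /andP[eS ePi] max_e -> -> /=.
have card_eS j : #|(e |: S) :&: part j| = ((j == i) + #|S :&: part j|)%N.
  by rewrite card_setU1I // (in_part_eq _ ePi).
have lt_i : (#|S :&: part i| < bud i)%N by rewrite -inI.
split.
- apply: (PS S e i fea _ PSS); split=> // e' j e'Pj e'S lt_j.
  by apply: (max_e e' j); rewrite ?inI // inE e'S.
- by move=> j; rewrite card_eS; case: eqVneq => [->|_] //; apply: fea.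
- move=> j; rewrite !card_eS eqxx; case: ifPn => h; rewrite ?inE inI.
    by case: eqVneq => [->|_] //=; rewrite ltnNge h.
  by case: eqVneq => [->|_] //=; rewrite lt_i; lia.
- by have := size_candidates I S; rewrite cardsU1 eS /=; nia.
Qed.

(** When the loop exits, [I] is empty, so no block has room left. *)
Lemma greedy_output_ind (P : {set V} -> Prop) Sb :
    P set0 ->
    (forall S e i, feasible part bud S -> greedy_choice S e i ->
       P S -> P (e |: S)) ->
    greedy_output part bud f Sb ->
  P Sb /\ forall i, #|Sb :&: part i| = bud i.
Proof.
move=> P0 PS [q /(greedy_reaches_ind_choice P0 PS)[/= PSb fea full _]].
split=> // i; apply/eqP; rewrite eqn_leq fea leqNgt -full inE //.
Qed.

Lemma greedy_queries st q : greedy_reaches part bud f st q ->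
  (q <= 2 * (#|V| * total_budget bud))%N.
Proof.
case/(@greedy_reaches_ind_choice (fun=> True)) => // _ /feasible_card le _ qle.
by apply: leq_trans qle _; rewrite !leq_mul.
Qed.

Lemma min_budget_le i : (min_budget bud <= bud i)%N.
Proof. exact: (@bigmin_le _ nat _ (total_budget bud) i bud). Qed.

Lemma min_budget_le_total : (min_budget bud <= total_budget bud)%N.
Proof. exact: (@bigmin_le_id _ nat _ _ (total_budget bud) predT bud). Qed.

Lemma min_budget_gt0 : (0 < k)%N -> (0 < min_budget bud)%N.
Proof.
move=> k0; rewrite /min_budget; elim/big_ind: _ => // [|x y x0 y0].
  rewrite /total_budget (bigD1 (Ordinal k0)) //=.
  by apply: leq_trans (bud_gt0 _) (leq_addr _ _).
by rewrite leq_min x0.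
Qed.

(** * The two approximation bounds *)

Hypotheses (f_mono : monotone_setfun f) (f0 : f set0 = 0).
Variables (gamma alpha : R) (Sopt : {set V}).
Hypotheses (gamma_dr : pm_dr_bound part bud f gamma).
Hypotheses (alpha_curv : pm_curvature_bound part bud f alpha).
Hypotheses (gamma_gt0 : 0 < gamma) (feaO : feasible part bud Sopt).

Let gamma_le1 : gamma <= 1. Proof. by case: gamma_dr => /andP[]. Qed.
Let alpha_ge0 : 0 <= alpha. Proof. by case: alpha_curv => /andP[]. Qed.
Let alpha_le1 : alpha <= 1. Proof. by case: alpha_curv => /andP[]. Qed.

Lemma marginal_ge0 e S : 0 <= marginal f e S.
Proof. by rewrite subr_ge0; apply: f_mono; rewrite subsetUr. Qed.

Lemma dr_marginal S T e : pm_triple part bud S T e ->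
  marginal f e T <= gamma^-1 * marginal f e S.
Proof.
case: gamma_dr => _ h /h; rewrite /le_scaled /inve.
by rewrite (negPf (lt0r_neq0 gamma_gt0)).
Qed.

Lemma greedy_exchange Sb : greedy_output part bud f Sb ->
  f Sopt <= (gamma^-1 + alpha) * f Sb.
Proof.
(* [O] is what is left of [Sopt] after trading its elements for greedy ones. *)
pose P S := exists O, [/\ {in O, forall x, x \notin S},
  forall i, (#|O :&: part i| + #|S :&: part i| <= bud i)%N
  & f Sopt <= f (S :|: O) + (gamma^-1 - 1 + alpha) * f S].
have ginv1 : 1 <= gamma^-1 by rewrite invf_ge1.
have a0 := alpha_ge0.
case/(@greedy_output_ind P) => [||[O [_ cO le]] full].
- exists Sopt; split=> [|i|]; first by move=> x; rewrite inE.
    by rewrite set0I cards0 addn0.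
  by rewrite set0U f0 mulr0 addr0.
- move=> S e i feaS [ePi eS lt_i max_e] [O [dis cO le]].
  have xge := marginal_ge0 e S.
  have card_eS j : #|(e |: S) :&: part j| = ((j == i) + #|S :&: part j|)%N.
    by rewrite card_setU1I // (in_part_eq _ ePi).
  have fE : f (e |: S) = f S + marginal f e S by rewrite /marginal; ring.
  have coef : 0 <= (gamma^-1 - 1 + alpha) * marginal f e S.
    by apply: mulr_ge0 => //; lra.
  have cardD1 o j : o \in part i -> o \in O ->
      (#|(O :\ o) :&: part j| + (j == i) = #|O :&: part j|)%N.
    move=> oPi oO; have := @card_setU1I (O :\ o) (part j) o.
    by rewrite setD1K // !inE eqxx (in_part_eq _ oPi) => ->; rewrite // addnC.
  (* If [e] lies in [O], it is traded for itself and the union is unchanged. *)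
  case: (boolP (e \in O)) => eO.
    exists (O :\ e); split=> [|j|].
    + by move=> x; rewrite !inE negb_or => /andP[-> /dis].
    + by rewrite card_eS addnA cardD1.
    + have -> : (e |: S) :|: (O :\ e) = S :|: O.
        by rewrite setUAC setD1K // setUC.
      by rewrite fE mulrDr; lra.
  (* If [O] misses block [i], adding [e] breaks no budget and monotonicity suffices. *)
  case: (set_0Vmem (O :&: part i)) => [Oi0|[o]].
    exists O; split=> [|j|].
    + move=> x xO; rewrite !inE negb_or dis // andbT.
      by apply: contraNneq eO => <-.
    + rewrite card_eS; have := cO j; case: eqVneq => [->|//].
      by rewrite Oi0 cards0; lia.
    + have := f_mono (subsetUr [set e] (S :|: O)); rewrite setUA fE mulrDr; lra.
  rewrite inE => /andP[oO oPi].
  have oS : o \notin S by apply: dis.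
  (* [T] is the common base of the trade. Over it, [o] restores [S :|: O] and gains at most
     [gamma^-1 * x], with [x] the greedy gain, while [e] gains at least [(1 - alpha) * x]. The
     difference gives the coefficient in [P]. *)
  set T := S :|: (O :\ o).
  have TS : T :\: S \subset O.
    by apply/subsetP => x; rewrite !inE; case: (x \in S) => //= /andP[].
  have ST : forall j, (#|(T :\: S) :&: part j| <= bud j)%N.
    move=> j; apply: leq_trans (subset_leq_card (setSI _ TS)) _.
    exact: leq_trans (leq_addr _ _) (cO j).
  have oT : pm_triple part bud S T o.
    by split; rewrite ?subsetUl // !inE eqxx (negPf oS).
  have eT : pm_triple part bud S T e.
    by split; rewrite ?subsetUl // !inE (negPf eS) (negPf eO) andbF.
  exists (O :\ o); split=> [|j|].
  + move=> x; rewrite !inE negb_or => /andP[_ xO]; rewrite dis // andbT.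
    by apply: contraNneq eO => <-.
  + by rewrite card_eS addnA cardD1.
  + have := dr_marginal oT; have [_ /(_ _ _ _ eT)] := alpha_curv.
    have := max_e o i oPi oS lt_i; set x := marginal f e S.
    rewrite -setUA -/T /marginal.
    have -> : o |: T = S :|: O by rewrite /T setUCA setD1K.
    set y := f (o |: S) - f S => yx h1 h2.
    have h3 : gamma^-1 * y <= gamma^-1 * x by apply: ler_wpM2l => //; lra.
    by rewrite fE -/x mulrDr; lra.
(* Every block is filled by [Sb], so nothing is left of the optimum. *)
have O0 : O = set0.
  apply/eqP; rewrite -cards_eq0 card_sum_part sum_nat_eq0; apply/forallP => i.
  by have := cO i; rewrite full; lia.
by move: le; rewrite O0 setU0; lra.
Qed.

(** Add the elements of [T :\: S] to [S] one by one. Each intermediate set exceeds [S] only by part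
    of the feasible set [T], so [dr_marginal] bounds each gain by [gamma^-1 * x]. *)
Lemma union_marginal_bound S T x : feasible part bud T ->
    (forall e, e \in T -> e \notin S -> marginal f e S <= x) -> 0 <= x ->
  f (T :|: S) - f S <= gamma^-1 * (#|T :\: S|%:R * x).
Proof.
move: {2}(#|T :\: S|) (erefl #|T :\: S|) => n.
elim: n T => [|n IH] T cT feaT le_x x0.
  have /setUidPr -> : T \subset S by rewrite -setD_eq0 -cards_eq0 cT.
  by rewrite subrr cT mul0r mulr0.
have /card_gt0P[e] : (0 < #|T :\: S|)%N by rewrite cT.
rewrite inE => /andP[eS eT].
have TDe : (T :\ e) :\: S = (T :\: S) :\ e by rewrite !setDDl setUC.
have cTe : #|(T :\ e) :\: S| = n.
  rewrite TDe; have := cardsD1 e (T :\: S); rewrite cT inE eS eT; lia.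
have feaTe : feasible part bud (T :\ e).
  move=> i; apply: leq_trans (feaT i).
  by rewrite subset_leq_card // setSI ?subD1set.
have h1 := IH _ cTe feaTe.
have {}h1 : f (T :\ e :|: S) - f S <= gamma^-1 * (#|T :\ e :\: S|%:R * x).
  by apply: h1 => // e'; rewrite inE => /andP[_]; apply: le_x.
have trip : pm_triple part bud S (T :\ e :|: S) e.
  split; rewrite ?subsetUr ?inE ?eqxx //.
  move=> i; apply: leq_trans (feaTe i); rewrite subset_leq_card // setSI //.
  by apply/subsetP => y; rewrite !inE; case: (y \in S) => //=; rewrite orbF.
have := dr_marginal trip; rewrite /marginal setUA setD1K // -/(marginal f e S).
have := le_x e eT eS; set y := marginal f e S => yx h2.
rewrite cTe in h1; rewrite cT -natr1 mulrDl mul1r mulrDr.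
have : gamma^-1 * y <= gamma^-1 * x.
  by apply: ler_wpM2l; rewrite // invr_ge0 ltW.
lra.
Qed.

Let N := min_budget bud.
Let b := total_budget bud.

Lemma greedy_geometric Sb : greedy_output part bud f Sb ->
  geom_ratio gamma alpha N b * f Sopt <= f Sb.
Proof.
pose P S := geom_ratio gamma alpha N b * f Sopt <= f S +
  (f (Sopt :|: S) - f S) *
    geom_ratio gamma alpha (N - #|S|) (b - #|Sopt :&: S|).
have Nb : (N <= b)%N := min_budget_le_total.
have geom0 c : geom_ratio gamma alpha 0 c = 0.
  by rewrite /geom_ratio big_ord0 mulr0.
case/(@greedy_output_ind P) => [||PSb full].
- by rewrite /P setU0 setI0 !cards0 !subn0 f0 subr0 add0r mulrC.
- move=> S e i feaS [ePi eS lt_i max_e] PS.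
  (* After [N] steps the second term of the potential is an empty sum, and monotonicity of [f]
     suffices. *)
  have [NS|SN] := leqP N #|S|.
    move: PS; rewrite /P cardsU1 eS.
    have -> : (N - #|S| = 0)%N by lia.
    have -> : (N - (true + #|S|) = 0)%N by lia.
    rewrite !geom0 !mulr0 !addr0 => /le_trans; apply.
    exact/f_mono/subsetUr.
  have lt_j j : (#|S :&: part j| < bud j)%N.
    apply: leq_ltn_trans (subset_leq_card (subsetIl _ _)) _.
    exact: leq_trans SN (min_budget_le j).
  have xge := marginal_ge0 e S.
  have cOb : (#|Sopt| <= b)%N := feasible_card feaO.
  have cI : (#|Sopt :&: S| <= #|S|)%N by rewrite subset_leq_card ?subsetIr.
  have Dge : 0 <= f (Sopt :|: S) - f S by rewrite subr_ge0 f_mono ?subsetUr.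
  (* [Sopt] has at most [b] elements, so at most [b - #|Sopt :&: S|] of them lie outside [S]. *)
  have gD : gamma * (f (Sopt :|: S) - f S)
      <= (b - #|Sopt :&: S|)%:R * marginal f e S.
    rewrite mulrC -ler_pdivlMr // mulrC.
    have /le_trans : f (Sopt :|: S) - f S
        <= gamma^-1 * (#|Sopt :\: S|%:R * marginal f e S).
      apply: union_marginal_bound => // e' _ e'S.
      by have [j e'Pj] := in_part_ex e'; apply: (max_e e' j).
    apply; apply: ler_wpM2l; first by rewrite invr_ge0 ltW.
    by apply: ler_wpM2r => //; rewrite ler_nat cardsD leq_sub2r.
  apply: (le_trans PS).
  have fE : f (e |: S) = f S + marginal f e S by rewrite /marginal; ring.
  rewrite fE -addrA lerD2l cardsU1 eS add1n.
  rewrite (setIC Sopt (e |: S)) card_setU1I //.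
  have -> : (N - #|S| = (N - #|S|.+1).+1)%N by lia.
  rewrite (setIC S Sopt); case: (boolP (e \in Sopt)) => eO.
    (* The subtraction is not truncated, because [#|Sopt :&: S| <= #|S| < N <= b]. *)
    have cE : (b - #|Sopt :&: S| = (b - (true + #|Sopt :&: S|)).+1)%N by lia.
    rewrite cE in gD *.
    have -> : Sopt :|: (e |: S) = Sopt :|: S.
      by rewrite setUCA setUA; congr (_ :|: _); apply/setUidPr; rewrite sub1set.
    rewrite [f S + _]addrC opprD addrA addrAC.
    by apply: geom_ratio_step_in => //; [exact: ltW | lia].
  rewrite add0n; apply: geom_ratio_step_out => //; [exact: ltW | lia |].
  have trip : pm_triple part bud S (Sopt :|: S) e.
    split; rewrite ?subsetUr ?inE ?negb_or ?eO ?eS //.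
    move=> j; apply: leq_trans (feaO j); rewrite subset_leq_card // setSI //.
    by apply/subsetP => y; rewrite !inE; case: (y \in S) => //=; rewrite orbF.
  have [_ /(_ _ _ _ trip)] := alpha_curv.
  have -> : Sopt :|: (e |: S) = e |: (Sopt :|: S) by rewrite setUCA.
  by rewrite [marginal f e (Sopt :|: S)]/marginal; lra.
have cSb : #|Sb| = b.
  by rewrite card_sum_part; apply: eq_bigr => i _; apply: full.
move: PSb; rewrite /P cSb.
have -> : (N - b = 0)%N by lia.
by rewrite geom0 mulr0 addr0.
Qed.

(** For [alpha != 0] this sums the geometric series, whose denominator [alpha * gamma / b] absorbs
    [alpha^-1]; for [alpha = 0] all [N] terms equal 1. *)
Lemma ratio2E : (0 < k)%N ->
  ratio2 bud gamma alpha = geom_ratio gamma alpha N b.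
Proof.
move=> k0; have b0 : b%:R != 0 :> R.
  rewrite pnatr_eq0 -lt0n.
  exact: leq_trans (min_budget_gt0 k0) min_budget_le_total.
rewrite /ratio2 /geom_ratio -/N -/b; case: eqVneq => [->|a0].
  under eq_bigr do rewrite !mul0r subr0 expr1n.
  by rewrite sumr_const card_ord mulrAC.
have := subrX1 (1 - alpha * gamma / b%:R) N.
rewrite -[1 - _ ^+ _]opprB => ->; field.
by rewrite b0.
Qed.

(** The term [j = 0] is already positive. This makes the inverse of [ratio2] a finite factor. *)
Lemma geom_ratio_gt0 : (0 < k)%N -> 0 < geom_ratio gamma alpha N b.
Proof.
move=> k0; have N0 := min_budget_gt0 k0.
have b0 : (0 < b)%N by apply: leq_trans N0 min_budget_le_total.
have bR : 1 <= b%:R :> R by rewrite ler1n.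
rewrite /N -(prednK N0) /geom_ratio big_ord_recl expr0.
apply: mulr_gt0; first by rewrite divr_gt0 //; lra.
apply: ltr_wpDr => //; apply: sumr_ge0 => j _; apply: exprn_ge0.
rewrite subr_ge0 ler_pdivrMr ?mul1r; last lra.
by apply: le_trans bR; apply: mulr_ile1 => //; apply: ltW.
Qed.

End GreedyRuns.

Theorem theorem3 :
  exists C : nat,
  forall (R : realType) (V : finType) (k : nat)
    (part : 'I_k -> {set V}) (bud : 'I_k -> nat) (f : {set V} -> R)
    (gamma alpha : R) (Sopt : {set V}),
    (0 < k)%N ->
    is_partition part ->
    (forall i, (1 <= bud i <= #|part i|)%N) ->
    (forall S, 0 <= f S) ->
    monotone_setfun f ->
    f set0 = 0 ->
    is_pm_dr_ratio part bud f gamma ->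
    is_pm_curvature part bud f alpha ->
    is_optimal part bud f Sopt ->
    (forall Sb, greedy_output part bud f Sb ->
       le_scaled (f Sopt)
         (Order.min (inve (ratio1 gamma alpha)%:E)
                    (inve (ratio2 bud gamma alpha)%:E))
         (f Sb))
    /\ (forall st q, greedy_reaches part bud f st q ->
         (q <= C * (#|V| * total_budget bud))%N).
Proof.
(* Each marginal is evaluated with two queries. *)
exists 2%N => R V k part bud f gamma alpha Sopt k0 partP budP f_ge0 f_mono f0.
move=> [gdr _] [acurv _] [feaO _].
have bud0 i : (0 < bud i)%N by case/andP: (budP i).
split=> [Sb out|st q]; last exact: greedy_queries.
have /andP[g0 g1] := gdr.1; have /andP[a0 a1] := acurv.1.
(* At [gamma = 0] both ratios vanish, so the factor is [+oo] and nothing is claimed. *)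
have [g_eq0|g_neq0] := eqVneq gamma 0.
  rewrite /ratio1 /ratio2 g_eq0 mul0r !mulr0 !mul0r subr0 expr1n subrr mulr0.
  by rewrite if_same inve0 minxx.
have g_gt0 : 0 < gamma by rewrite lt_neqAle eq_sym g_neq0.
have h1 := greedy_exchange partP bud0 f_mono f0 gdr acurv g_gt0 feaO out.
have h2 := greedy_geometric partP bud0 f_mono f0 gdr acurv g_gt0 feaO out.
have r2_gt0 := geom_ratio_gt0 bud0 gdr acurv g_gt0 k0.
have den_gt0 : 0 < 1 + gamma * alpha by rewrite ltr_pwDl // mulr_ge0.
have r1_gt0 : 0 < ratio1 gamma alpha by rewrite divr_gt0.
rewrite /Order.min ratio2E // /inve !gt_eqF //; case: ifP => _ /=.
  (* The inverse of [ratio1] is [gamma^-1 + alpha]. *)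
  apply: le_trans h1 _; rewrite le_eqVlt; apply/orP; left; apply/eqP.
  by congr (_ * _); rewrite /ratio1; field; rewrite lt0r_neq0.
by rewrite mulrC ler_pdivlMr // mulrC.
Qed.
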